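(* Let $\mathbb{K}$ be a field. For any finite simple graph $G$ and for every even positive integer $k$, $${\rm reg}(J(G)^{(k)})\leq k\gamma_0(G).$$
   Context: For $V(G)=\{x_1,\ldots,x_n\}$, let $S=\mathbb{K}[x_1,\ldots,x_n]$. The cover ideal is $J(G)=\bigcap_{x_ix_j\in E(G)}(x_i,x_j)$ and its $k$-th symbolic power is $J(G)^{(k)}=\bigcap_{x_ix_j\in E(G)}(x_i,x_j)^k$ (both equal $S$ if $G$ has no edges). The regularity of a graded $S$-module $M$ is ${\rm reg}(M)=\max\{j-i\mid \beta_{i,j}(M)\neq 0\}$. For a set $A$ of vertices, $N_G(A)=\bigcup_{x\in A}N_G(x)$ and $N_G[A]=N_G(A)\cup A$; $G\setminus B$ denotes the graph obtained by deleting the vertices in $B$. Define $$\gamma_0(G)=\max\Big\{\tfrac{|V(G)|+|N_G(A)|-|A|}{2}\;\Big|\; A \text{ is a (possibly empty) independent set of } G \text{ and any bipartite connected component of } G\setminus N_G[A] \text{ is an isolated vertex}\Big\}.$$ *)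

(* Defs.v *)
From HB Require Import structures.
From mathcomp Require Import all_boot all_order all_algebra.
From mathcomp Require Import mpoly.

Set Implicit Arguments.
Unset Strict Implicit.
Unset Printing Implicit Defensive.

Import Order.TTheory GRing.Theory Num.Theory.
Local Open Scope ring_scope.

Record sgraph (T : finType) := SGraph {
  adj :> rel T;
  adj_sym : ssrbool.symmetric adj;
  adj_irr : ssrbool.irreflexive adj }.

Section Graphs.
Variables (T : finType) (G : sgraph T).

Definition nbhd (A : {set T}) : {set T} := [set y | [exists x in A, G x y]].

Definition closed_nbhd (A : {set T}) : {set T} := nbhd A :|: A.

Definition independent (A : {set T}) : bool :=
  [forall x in A, forall y in A, ~~ G x y].

Definition components : {set {set T}} :=
  [set [set y | connect G x y] | x : T].

(* The subgraph induced on C is bipartite, with parts C :&: B and C :\: B. *)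
Definition bipartite (C : {set T}) : bool :=
  [exists B : {set T}, [forall x in C, forall y in C,
    G x y ==> ((x \in B) != (y \in B))]].

Definition delete (B : {set T}) : sgraph {x : T | x \notin B} :=
  @SGraph {x : T | x \notin B} (fun x y => G (val x) (val y))
    (fun x y => adj_sym G (val x) (val y)) (fun x => adj_irr G (val x)).

End Graphs.

Definition gamma0_admissible (T : finType) (G : sgraph T) (A : {set T}) : bool :=
  independent G A &&
  [forall C in components (delete G (closed_nbhd G A)),
     bipartite (delete G (closed_nbhd G A)) C ==> (#|C| == 1%N)].

(* The default value 0 of the big maximum plays no role: every maximal
   independent set is admissible and #|A| <= #|T| makes each term nonnegative. *)
Definition gamma0 (T : finType) (G : sgraph T) : rat :=
  \big[Num.max/0]_(A : {set T} | gamma0_admissible G A)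
    ((#|T|%:R + #|nbhd G A|%:R - #|A|%:R) / 2%:R).

Section Ideals.
Variables (K : fieldType) (n : nat).
Local Notation S := {mpoly K[n]}.

Definition ideal_gen (A : S -> Prop) (f : S) : Prop :=
  exists s : seq (S * S),
    (forall p, p \in s -> A p.2) /\ f = \sum_(p <- s) p.1 * p.2.

Definition ideal_exp (I : S -> Prop) (k : nat) : S -> Prop :=
  ideal_gen (fun f => exists t : k.-tuple S,
    (forall g, g \in t -> I g) /\ f = \prod_(g <- t) g).

Definition edge_prime (i j : 'I_n) : S -> Prop :=
  ideal_gen (fun f => f = 'X_i \/ f = 'X_j).

(* For k = 1 this is the cover ideal J(G). *)
Definition cover_symbolic_power (G : sgraph 'I_n) (k : nat) (f : S) : Prop :=
  forall i j : 'I_n, G i j -> ideal_exp (edge_prime i j) k f.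

End Ideals.

(* A sequence ... -> F_1 -> F_0 -> S of finitely generated graded free modules,
   F_i = \bigoplus_(r < rank i) S(- shift r).  Elements of F_i are row vectors
   and the maps act by multiplication on the right. *)
Record free_sequence (K : fieldType) (n : nat) := FreeSequence {
  rank : nat -> nat;
  shift : forall i : nat, 'I_(rank i) -> int;
  aug : 'cV[{mpoly K[n]}]_(rank 0);
  diff : forall i : nat, 'M[{mpoly K[n]}]_(rank i.+1, rank i) }.

Section Resolutions.
Variables (K : fieldType) (n : nat).
Local Notation S := {mpoly K[n]}.
Implicit Types (F : free_sequence K n) (I : S -> Prop).

(* All maps have degree 0; the zero entry is homogeneous of every degree. *)
Definition graded_sequence F : Prop :=
  (forall (r : 'I_(rank F 0)) (m : 'X_{1..n}),
     m \in msupp (aug F r 0) -> shift r = (mdeg m)%:Z)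
  /\
  (forall (i : nat) (r : 'I_(rank F i.+1)) (c : 'I_(rank F i)) (m : 'X_{1..n}),
     m \in msupp (diff F i r c) -> shift r = shift c + (mdeg m)%:Z).

Definition resolves F I : Prop :=
  [/\ forall f : S, I f <-> exists u : 'rV_(rank F 0), f = (u *m aug F) 0 0,
      forall u : 'rV_(rank F 0),
        u *m aug F = 0 <-> exists v, u = v *m diff F 0
    & forall (i : nat) (u : 'rV_(rank F i.+1)),
        u *m diff F i = 0 <-> exists v, u = v *m diff F i.+1].

(* The image of F_(i+1) lies in (x_1, ..., x_n) F_i. *)
Definition minimal_sequence F : Prop :=
  forall (i : nat) (r : 'I_(rank F i.+1)) (c : 'I_(rank F i)),
    (diff F i r c)@_0%MM = 0.

Definition minimal_graded_free_resolution F I : Prop :=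
  [/\ graded_sequence F, resolves F I & minimal_sequence F].

Definition betti F (i : nat) (j : int) : nat :=
  #|[set r : 'I_(rank F i) | shift r == j]|.

(* reg(I) <= c.  The minimal graded free resolution is unique up to
   isomorphism, so its Betti numbers are those of I, and the maximum
   reg(I) of the differences j - i is at most c iff all of them are. *)
Definition regularity_le I (c : rat) : Prop :=
  forall F, minimal_graded_free_resolution F I ->
    forall (i : nat) (j : int), betti F i j <> 0%N -> (j - i%:Z)%:~R <= c.

End Resolutions.

(* Main.v *)
Require Import Defs.
From mathcomp Require Import all_boot all_order all_algebra.
From mathcomp Require Import mpoly.
From mathcomp Require Import ring zify.

Set Implicit Arguments.
Unset Strict Implicit.
Unset Printing Implicit Defensive.

Import Order.TTheory GRing.Theory Num.Theory.
Local Open Scope ring_scope.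

(** Let [I] be the [k]-th symbolic power, [k = 2m], and write [n] for the number
    of vertices.  A polynomial lies in [I] iff each of its exponents [a]
    satisfies [a_u + a_v >= k] on every edge ([cover_symbolic_powerE]), so [I] is
    a monomial ideal.

    Passage to topology.  A generator of degree [j] of the [i]-th module of a
    minimal resolution yields, by a diagram chase through the Koszul complexes
    of the syzygy modules, a Koszul [i]-cycle of degree [j] with coefficients in
    [I] that is not a boundary ([resolution_generator]).  Split by multidegree,
    the Koszul complex of [I] becomes the family of augmented chain complexes of
    the simplicial complexes [K^b] whose faces are the sets [t <= b] with
    [x^(b - t)] in [I] ([koszul_exact]).  It remains to see that [K^b] has no
    reduced homology on faces of cardinality [i] when [|b| - i > k gamma_0(G)]
    ([acyclic_upper_koszul]).

    Shape of [K^b].  If [x^b] is not in [I] there are no faces.  Otherwise [K^b]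
    is the independence complex of a graph [H] ([upper_koszul_independence]):
    its vertices are the [u] with [b_u > 0] lying on no edge with
    [b_u + b_v = k], its edges those edges of [G] with [b_u + b_v = k + 1].
    Here the parity of [k] enters: an edge of [H] has exactly one end with
    value at most [m].  Hence [H] is bipartite with parts [Q = {b_u <= m}] and
    [P = {b_u > m}].  A deletion and link induction over [Q] shows that [K^b] is
    acyclic in cardinality [i] as soon as [i < |P \ N_H(B)| + |B|] for
    all [B] inside [Q] ([acyclic_independence]).  One may also assume that [H] has no
    isolated vertex, since such a vertex makes [K^b] a cone.

    The inequality.  Fix [B] inside [Q].  For each threshold [t < m] the set
    [C_t] of the [u] with [b_u <= t], or with [u] in [B] and [b_u = t + 1], is
    independent in [G].  Writing [b_u - m] as a sum of threshold indicators and
    summing over [t] gives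
    [|b| <= |P \ N_H(B)| + |B| + sum_t (n + |N(C_t)| - |C_t|)] ([mdeg_bound]).
    Finally each independent set [A] is dominated by one allowed in the
    definition of [gamma_0] ([admissible_dominates]): while some bipartite
    component outside [N[A]] has an edge, adding the smaller colour class of it
    to [A] does not decrease [|N(A)| - |A|].  So the last sum is at most
    [2 m gamma_0(G)], which is [k gamma_0(G)]. *)

(** * The Koszul differential and its homotopies *)

Section Koszul.
Variable n : nat.
Implicit Types (u v : 'I_n) (s t : {set 'I_n}).

Definition rank_in u s := #|[set w in s | (w < u)%N]|.

Lemma rank_inU1 u v s : v \notin s -> rank_in u (v |: s) = ((v < u) + rank_in u s)%N.
Proof.
move=> vs; rewrite /rank_in.
have [lt_vu|le_uv] := ltnP v u.
  rewrite (_ : [set _ in _ | _] = v |: [set w in s | (w < u)%N]).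
    by rewrite cardsU1 inE (negPf vs).
  by apply/setP=> w; rewrite !inE; case: eqP => // ->; rewrite lt_vu.
congr #|pred_of_set _|; apply/setP=> w; rewrite !inE.
by case: eqP => // ->; rewrite (negPf vs) ltnNge le_uv.
Qed.

Section Differential.
Variables (R : comNzRingType) (V : lmodType R).
Implicit Types (x y : 'I_n -> R) (z : {set 'I_n} -> V).

(** The Koszul differential of the sequence [x] with coefficients in [V]; a chain
    is the family of its coefficients, [z s] being that of the exterior monomial
    [e_s].  With [x = 1] this is the augmented simplicial boundary. *)
Definition koszul x z s : V :=
  \sum_(u | u \notin s) ((-1) ^+ rank_in u s * x u) *: z (u |: s).

Lemma eq_koszul x z z' s : z =1 z' -> koszul x z s = koszul x z' s.
Proof. by move=> eqz; apply: eq_bigr => u _; rewrite eqz. Qed.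

Lemma koszulB x z z' s :
  koszul x (fun t => z t - z' t) s = koszul x z s - koszul x z' s.
Proof. by rewrite -sumrB; apply: eq_bigr => u _; rewrite scalerBr. Qed.

Lemma koszulN x z s : koszul x (fun t => - z t) s = - koszul x z s.
Proof. by rewrite -sumrN; apply: eq_bigr => u _; rewrite scalerN. Qed.

Lemma koszul0 x z s : (forall u, u \notin s -> z (u |: s) = 0) -> koszul x z s = 0.
Proof. by move=> z0; apply: big1 => u us; rewrite z0 ?scaler0. Qed.

Lemma sign_swap u v s : u != v -> u \notin s -> v \notin s ->
  (-1) ^+ rank_in u s * (-1) ^+ rank_in v (u |: s)
    = - ((-1) ^+ rank_in v s * (-1) ^+ rank_in u (v |: s)) :> R.
Proof.
move=> uv us vs; rewrite !rank_inU1 // !exprD.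
move: uv; rewrite -val_eqE neq_ltn.
by case/orP=> lt_uv; rewrite lt_uv ltnNge ltnW //= expr0 expr1; ring.
Qed.

(** Both the anticommutation and the vanishing of the square come from this
    symmetric form, where exchanging [u] and [v] only flips the sign. *)
Lemma koszul_koszulE x y z s :
  koszul x (koszul y z) s = \sum_u \sum_v
    if [&& u != v, u \notin s & v \notin s] then
      ((-1) ^+ rank_in u s * (-1) ^+ rank_in v (u |: s) * x u * y v)
        *: z (u |: (v |: s)) else 0.
Proof.
rewrite /koszul big_mkcond; apply: eq_bigr => u _.
case us: (u \in s) => /=.
  by rewrite big1 // => v _; rewrite andbF.
rewrite scaler_sumr big_mkcond; apply: eq_bigr => v _.
rewrite in_setU1 negb_or eq_sym; case: ifP => // _.
by rewrite scalerA setUCA; congr (_ *: _); ring.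
Qed.

Lemma koszul_anticomm x y z s :
  koszul x (koszul y z) s = - koszul y (koszul x z) s.
Proof.
rewrite !koszul_koszulE exchange_big -sumrN; apply: eq_bigr => u _.
rewrite -sumrN; apply: eq_bigr => v _.
rewrite eq_sym [(v \notin s) && _]andbC; case: ifP => [/and3P[uv us vs]|]; last by rewrite oppr0.
by rewrite -scaleNr (sign_swap (u:=v)) 1?eq_sym // setUCA; congr (_ *: _); ring.
Qed.

(** Oddness alone would not give zero in characteristic 2, hence the second
    hypothesis and the pairing of [u < v] with [v < u]. *)
Lemma sum_antisym (F : 'I_n -> 'I_n -> V) :
  (forall u v, F u v = - F v u) -> (forall u, F u u = 0) -> \sum_u \sum_v F u v = 0.
Proof.
move=> FN F0.
have -> : \sum_u \sum_v F u v =
    \sum_(u : 'I_n) \sum_(v : 'I_n | (u < v)%N) F u v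
      + \sum_(u : 'I_n) \sum_(v : 'I_n | (v < u)%N) F u v.
  rewrite -big_split; apply: eq_bigr => u _ /=.
  rewrite (bigID (fun v : 'I_n => (u < v)%N)) /=; congr (_ + _).
  rewrite (bigD1 u) ?ltnn //= F0 add0r; apply: eq_bigl => v.
  by rewrite -leqNgt -val_eqE ltn_neqAle andbC.
rewrite [X in _ + X](exchange_big_dep xpredT) //= -big_split big1 // => u _.
by rewrite -big_split big1 // => v _; rewrite /= [F u v]FN addNr.
Qed.

Lemma koszul_sq x z s : koszul x (koszul x z) s = 0.
Proof.
rewrite koszul_koszulE; apply: sum_antisym => [u v|u]; last by rewrite eqxx.
rewrite eq_sym [(u \notin s) && _]andbC; case: ifP => [/and3P[vu vs us]|]; last by rewrite oppr0.
by rewrite -scaleNr (sign_swap (u:=u)) 1?eq_sym // setUCA; congr (_ *: _); ring.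
Qed.

(** Exterior multiplication by [e_u]. *)
Definition wedge u z t : V :=
  if u \in t then (-1) ^+ rank_in u (t :\ u) *: z (t :\ u) else 0.

(** Multiplication by [e_u] is a homotopy from multiplication by [x u] to zero; for [x = 1] this is
    the contraction of a cone with apex [u]. *)
Lemma koszul_wedge u x z s :
  koszul x (wedge u z) s + wedge u (koszul x z) s = x u *: z s.
Proof.
have sqs k : (-1) ^+ k * (-1) ^+ k = 1 :> R.
  by rewrite -exprD addnn -mul2n exprM sqrrN expr1n expr1n.
case us: (u \in s); last first.
  rewrite {2}/wedge us addr0 /koszul (bigD1 u) ?us //= big1 ?addr0 => [|v /andP[vs vu]].
    rewrite /wedge setU11 setU1K ?us // scalerA; congr (_ *: _).
    by rewrite mulrAC sqs mul1r.
  by rewrite /wedge in_setU1 eq_sym (negPf vu) us scaler0.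
rewrite {2}/wedge us /koszul [in X in _ + X](bigD1 u) /=; last by rewrite !inE eqxx.
rewrite setD1K // scalerDr scalerA mulrA sqs mul1r addrCA -[RHS]addr0; congr (_ + _).
rewrite scaler_sumr [X in _ + X](eq_bigl (fun v => v \notin s)) => [|v]; last first.
  by rewrite !inE; case: eqP => [->|]; rewrite ?us // andbT.
rewrite -big_split big1 // => v vs /=.
have vu : v != u by apply: contraNneq vs => ->.
rewrite /wedge in_setU1 us orbT.
rewrite (_ : (v |: s) :\ u = v |: (s :\ u)); last first.
  by apply/setP=> w; rewrite !inE; case: (w =P v) => [->|//]; rewrite vu.
rewrite !scalerA -scalerDl -{1}(setD1K us).
set t := s :\ u; have ut : u \notin t by rewrite !inE eqxx.
have vt : v \notin t by rewrite !inE (negPf vs) andbF.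
have := sign_swap vu vt ut; set a := rank_in _ _; set b := rank_in _ _.
set c := rank_in _ _; set d := rank_in _ _ => E.
suff -> : (-1) ^+ d * x v * (-1) ^+ b + (-1) ^+ c * ((-1) ^+ a * x v) = 0 :> R
  by rewrite scale0r.
have E2 : ((-1) ^+ d * (-1) ^+ b) = - ((-1) ^+ c * (-1) ^+ a) :> R.
  move: (congr1 (fun r => (-1) ^+ d * r * (-1) ^+ a) E).
  rewrite mulrA [X in X = _](_ : _ = ((-1) ^+ a * (-1) ^+ a) * ((-1) ^+ d * (-1) ^+ b)); last by ring.
  rewrite [X in _ = X](_ : _ = ((-1) ^+ d * (-1) ^+ d) * - ((-1) ^+ c * (-1) ^+ a)); last by ring.
  by rewrite !sqs !mul1r.
rewrite [LHS](_ : _ = x v * ((-1) ^+ d * (-1) ^+ b + (-1) ^+ c * (-1) ^+ a)); last by ring.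
by rewrite E2 addNr mulr0.
Qed.

End Differential.
End Koszul.

(** * Acyclicity of independence complexes *)

Section Acyclic.
Variables (K : fieldType) (n : nat).
Implicit Types (u v : 'I_n) (s t : {set 'I_n}) (D : {pred {set 'I_n}}) (p : nat).

Local Notation boundary := (@koszul n K K^o (fun=> 1)).

Definition chain_on D p (f : {set 'I_n} -> K^o) :=
  forall t, f t != 0 -> (t \in D) && (#|t| == p).

(** Vanishing of the reduced homology of [D] in dimension [p - 1]: the index [p]
    counts vertices, as the empty face is a chain too. *)
Definition acyclic_at D p := forall f, chain_on D p f ->
  (forall t, boundary f t = 0) ->
  exists2 g, chain_on D p.+1 g & forall t, boundary g t = f t.

Lemma chain_wedge D D' p u f : chain_on D p f ->
  (forall t, t \in D -> u \notin t -> u |: t \in D') -> chain_on D' p.+1 (wedge u f).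
Proof.
move=> fD DD' t; rewrite /wedge; case: ifP => [ut|]; last by rewrite eqxx.
rewrite scaler_eq0 negb_or signr_eq0 => /fD /andP[tD /eqP tp].
by rewrite (cardsD1 u) ut tp -(setD1K ut) DD' //= ?inE ?eqxx.
Qed.

Lemma wedge0 u (f : {set 'I_n} -> K^o) t : (forall s, f s = 0) -> wedge u f t = 0.
Proof. by move=> f0; rewrite /wedge f0 scaler0 if_same. Qed.

Lemma acyclic_cone D p u : (forall t, t \in D -> u \notin t -> u |: t \in D) ->
  acyclic_at D p.
Proof.
move=> Du f fD df0; exists (wedge u f); first exact: chain_wedge fD Du.
by move=> t; have := koszul_wedge u (fun=> 1) f t; rewrite (wedge0 _ _ df0) addr0 scale1r.
Qed.

Lemma acyclic_void D p : (forall t, t \in D -> #|t| != p) -> acyclic_at D p.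
Proof.
move=> D0 f fD _; exists (fun=> 0) => [t|t]; first by rewrite eqxx.
rewrite koszul0 //; case: (eqVneq (f t) 0) => // /fD /andP[/D0 /negPf ->//].
Qed.

Lemma eq_acyclic D D' p : D =i D' -> acyclic_at D p -> acyclic_at D' p.
Proof.
move=> eqD aD f fD df0; have [t /fD|g gD dg] := aD f _ df0; first by rewrite eqD.
by exists g => // t /gD; rewrite eqD.
Qed.

(** Contraction by the dual of [e_u], that is the Koszul differential of a
    coordinate sequence: [koszul_anticomm] then makes it anticommute with the
    boundary. *)
Definition link_chain u (f : {set 'I_n} -> K^o) : {set 'I_n} -> K^o :=
  koszul (fun v => (v == u)%:R) f.

Lemma link_chainE u f t :
  link_chain u f t = if u \in t then 0 else (-1) ^+ rank_in u t *: f (u |: t).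
Proof.
rewrite /link_chain /koszul; case: ifP => ut.
  apply: big1 => v vt; case: eqP => [vu|_]; last by rewrite mulr0 scale0r.
  by rewrite vu ut in vt.
rewrite (bigD1 u) ?ut //= eqxx mulr1 big1 ?addr0 // => v /andP[_ /negPf ->].
by rewrite mulr0 scale0r.
Qed.

Lemma wedge_link u f t : wedge u (link_chain u f) t = if u \in t then f t else 0.
Proof.
rewrite /wedge; case: ifP => // ut; rewrite link_chainE !inE eqxx /= setD1K // scalerA.
by rewrite -exprD addnn -mul2n exprM sqrrN expr1n expr1n scale1r.
Qed.

Section Independence.
Variable e : rel 'I_n.
Hypotheses (e_sym : ssrbool.symmetric e) (e_irr : ssrbool.irreflexive e).

Definition independence_complex (U : {set 'I_n}) : {pred {set 'I_n}} :=
  fun t => (t \subset U) && [forall u in t, forall v in t, ~~ e u v].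

Lemma independence_complexP (U t : {set 'I_n}) :
  reflect (t \subset U /\ {in t &, forall u v, ~~ e u v}) (t \in independence_complex U).
Proof.
apply: (iffP andP) => -[tU H]; split=> //.
  by move=> u v ut vt; have /forall_inP/(_ u ut)/forall_inP/(_ v vt) := H.
by apply/forall_inP=> u ut; apply/forall_inP=> v vt; apply: H.
Qed.

(** The analogue of [nbhd] for a bare relation, as the graphs on the critical
    edges of a multidegree are not packed as [sgraph]. *)
Definition enbhd (A : {set 'I_n}) : {set 'I_n} := [set v | [exists u in A, e u v]].

(** Deletion and link of a vertex [q] of the cover [Q]: a homology class of the
    independence complex comes from the deletion, where one uses the subsets of
    [Q] avoiding [q], or maps to a class of the link one dimension lower, where
    one uses the subsets containing [q].  When [Q] is empty the complex is a
    simplex, and the hypothesis for [B = set0] says that this simplex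
    has a vertex, so that it is a cone. *)
Lemma acyclic_independence (Q U : {set 'I_n}) p : Q \subset U ->
  {in U :\: Q &, forall u v, ~~ e u v} ->
  (forall B : {set 'I_n}, B \subset Q -> (p < #|(U :\: Q) :\: enbhd B| + #|B|)%N) ->
  acyclic_at (independence_complex U) p.
Proof.
elim: {Q}#|Q| {-2}Q (leqnn #|Q|) U p => [|m IHm] Q.
  rewrite leqn0 cards_eq0 => /eqP-> U p _ indU /(_ set0 (sub0set _)).
  rewrite setD0 cards0 addn0 => /(leq_ltn_trans (leq0n _)).
  rewrite card_gt0 => /set0Pn[u /setDP[uU _]] ; apply: (acyclic_cone (u:=u)) => t.
  move=> /independence_complexP[tU _] ut; apply/independence_complexP.
  have sU : u |: t \subset U by rewrite subUset sub1set uU.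
  split=> // v w /(subsetP sU) vU /(subsetP sU) wU.
  by apply: indU; rewrite inE ?inE.
move=> leQ U p QU indU ltp.
have [Q0|/set0Pn[q qQ]] := eqVneq Q set0; first by apply: (IHm Q) => //; rewrite Q0 cards0.
have qU := subsetP QU q qQ.
have ltQ : (#|Q :\ q| <= m)%N by move: leQ; rewrite (cardsD1 q) qQ.
pose Ul := [set v in U | (v != q) && ~~ e q v]; pose Ql := Q :&: Ul.
have PlE : Ul :\: Ql = (U :\: Q) :\: enbhd [set q].
  apply/setP=> v; rewrite !inE; case vU: (v \in U); rewrite ?andbF ?andbT //=.
  case vQ: (v \in Q); rewrite ?andbF //=.
    by case: eqP; case: (e q v).
  have -> : [exists x in [set q], e x v] = e q v.
    by apply/exists_inP/idP => [[x /set1P->]|]//; exists q; rewrite ?inE.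
  by rewrite andbT; case: eqP vQ => // ->; rewrite qQ.
have UlP t : q \notin t -> (q |: t \in independence_complex U) =
    (t \in independence_complex Ul).
  move=> qt; apply/independence_complexP/independence_complexP => -[tU ind]; split.
  - apply/subsetP=> v vt; rewrite inE (subsetP tU) ?inE ?vt ?orbT //=.
    rewrite ind ?inE ?eqxx ?vt ?orbT // andbT.
    by apply: contraNneq qt => <-.
  - by move=> u v ut vt; apply: ind; rewrite inE ?ut ?vt orbT.
  - by rewrite subUset sub1set qU; apply/subsetP=> v /(subsetP tU); rewrite inE => /andP[].
  move=> u v /setU1P[->|ut] /setU1P[->|vt]; first by rewrite e_irr.
  - by have := subsetP tU v vt; rewrite inE => /and3P[].
  - by rewrite e_sym; have := subsetP tU u ut; rewrite inE => /and3P[].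
  exact: ind.
have UlU t : t \in independence_complex Ul -> t \in independence_complex (U :\ q).
  case/independence_complexP=> tU ind; apply/independence_complexP; split=> //.
  by apply: subset_trans tU _; apply/subsetP=> v; rewrite !inE => /and3P[-> -> _].
have acU : acyclic_at (independence_complex (U :\ q)) p.
  have PE : (U :\ q) :\: (Q :\ q) = U :\: Q.
    by apply/setP=> v; rewrite !inE; case: eqP => [->|//]; rewrite qQ.
  apply: (IHm (Q :\ q)) => //; rewrite ?setSD ?PE // => B BQ; apply: ltp.
  exact: subset_trans BQ (subD1set _ _).
move=> f fU df0.
(* [f] splits as the part avoiding q plus q times a cycle of the link; that cycle
   bounds a chain g of the link. *)
have [g gU dg] : exists2 g, chain_on (independence_complex Ul) p g &
    forall t, boundary g t = link_chain q f t.
  have lf t : link_chain q f t != 0 -> (t \in independence_complex Ul) && (#|t|.+1 == p).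
    rewrite link_chainE; case: ifP => qt; rewrite ?eqxx //.
    rewrite scaler_eq0 negb_or signr_eq0 => /fU.
    by rewrite UlP ?qt // cardsU1 qt add1n.
  case: p ltp {acU fU} lf => [|p] ltp lf.
    exists (fun=> 0) => t; first by rewrite eqxx.
    rewrite koszul0 //; case: (eqVneq (link_chain q f t) 0) => // /lf /andP[]//.
  have acUl : acyclic_at (independence_complex Ul) p.
    apply: (IHm Ql).
    - apply: leq_trans ltQ; apply: subset_leq_card.
      by apply/subsetP=> v; rewrite !inE => /and4P[-> _ -> _].
    - exact: subsetIr.
    - by rewrite PlE => u v /setDP[uU _] /setDP[vU _]; apply: indU.
    move=> B BQ; rewrite PlE.
    have qB : q \notin B by apply/negP=> /(subsetP BQ); rewrite !inE eqxx /= !andbF.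
    have := ltp (q |: B); rewrite cardsU1 qB /= add1n addnS ltnS subUset sub1set qQ.
    rewrite (subset_trans BQ (subsetIl _ _)) => /(_ isT).
    suff -> : enbhd (q |: B) = enbhd [set q] :|: enbhd B by rewrite -setDDl.
    apply/esym/setP=> v; rewrite !inE; apply/orP/exists_inP.
      by case=> /exists_inP[x xB exv]; exists x => //; rewrite inE ?xB ?orbT // -in_set1 xB.
    by case=> x /setU1P[->|xB] exv; [left|right]; apply/exists_inP; [exists q|exists x]; rewrite ?inE.
  apply: acUl lf _ => t; rewrite /link_chain koszul_anticomm koszul0 ?oppr0 //.
(* Subtracting the boundary of q times g, up to sign, moves f into the deletion of q. *)
pose f' t := f t - (if q \in t then f t else 0) + g t.
have f'E t : f' t = f t - - boundary (wedge q g) t.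
  have := koszul_wedge q (fun=> 1) g t; rewrite scale1r => /(canRL (addrK _)) ->.
  rewrite opprK /f' -addrA; congr (_ + _); rewrite addrC; congr (_ - _).
  rewrite -(wedge_link q f t) /wedge; case: ifP => // _.
  by rewrite dg.
have [g' g'U dg'] : exists2 g', chain_on (independence_complex (U :\ q)) p.+1 g' &
    forall t, boundary g' t = f' t.
  apply: acU => [t|t].
    have [gt0|/gU/andP[/UlU -> ->]//] := eqVneq (g t) 0.
    rewrite /f' gt0 addr0; case: ifP => qt; first by rewrite subrr eqxx.
    rewrite subr0 => /fU/andP[/independence_complexP[tU ind] ->]; rewrite andbT.
    by apply/independence_complexP; split=> //; rewrite subsetD1 tU qt.
  rewrite (eq_koszul _ _ f'E) koszulB df0 sub0r.
  by rewrite koszulN opprK koszul_sq.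
exists (fun t => g' t - wedge q g t) => t; last first.
  by rewrite koszulB dg' f'E opprK addrK.
have [g'0|/g'U/andP[/independence_complexP[tU ind] -> _]] := eqVneq (g' t) 0; last first.
  rewrite andbT; apply/independence_complexP; split=> //.
  exact: subset_trans tU (subD1set _ _).
rewrite g'0 sub0r oppr_eq0; apply: (chain_wedge gU) => s sU qs; by rewrite UlP.
Qed.

End Independence.
End Acyclic.

(** * Koszul complexes of the exponents of a symbolic power *)

Definition indicator_mnm n (t : {set 'I_n}) : 'X_{1..n} :=
  [multinom (i \in t : nat) | i < n].

(** The faces [t] for which the monomial of exponent [b - t] has its exponent in
    [P]; its homology computes the Koszul homology in multidegree [b] of the
    monomial ideal with exponents [P]. *)
Definition upper_koszul n (P : pred 'X_{1..n}) (b : 'X_{1..n}) : {pred {set 'I_n}} :=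
  fun t => (indicator_mnm t <= b)%MM && P (b - indicator_mnm t)%MM.

(** Layer-cake formula: [m - c] counts the thresholds [t < m] with [t >= c]. *)
Lemma sum_threshold m c : (\sum_(t < m) (c <= t) = m - c)%N.
Proof.
elim: m => [|m IHm]; first by rewrite big_ord0.
rewrite big_ord_recr /= IHm; lia.
Qed.

Lemma sum_point m c : (\sum_(t < m) (t == c :> nat) <= 1)%N.
Proof.
elim: m => [|m IHm]; first by rewrite big_ord0.
rewrite big_ord_recr /=; case: eqP => [<-|_]; last by rewrite addn0.
rewrite big1 // => t _; have := ltn_ord t; case: eqP => // ->; by rewrite ltnn.
Qed.

Lemma card_sum_mem (T : finType) (A : {set T}) : #|A| = (\sum_x (x \in A))%N.
Proof. by rewrite -sum1_card big_mkcond; apply: eq_bigr => x _; case: ifP. Qed.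

Lemma sum_card (I T : finType) (A : I -> {set T}) :
  (\sum_i #|A i| = \sum_x \sum_i (x \in A i))%N.
Proof. by rewrite exchange_big; apply: eq_bigr => i _; apply: card_sum_mem. Qed.

Section CoverIdeal.
Variables (n : nat) (G : sgraph 'I_n).
Implicit Types (b : 'X_{1..n}) (u v : 'I_n).

Definition symbolic_exponent k : pred 'X_{1..n} :=
  fun b => [forall u, forall v, G u v ==> (k <= b u + b v)%N].

Lemma symbolic_exponentP k b :
  reflect (forall u v, G u v -> (k <= b u + b v)%N) (symbolic_exponent k b).
Proof.
apply: (iffP forallP) => H u; first by move=> v; apply/implyP; have /forallP := H u.
by apply/forallP=> v; apply/implyP; apply: H.
Qed.

Section DegreeComplex.
Variables (k : nat) (b : 'X_{1..n}).
Hypothesis b_sym : symbolic_exponent k b.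

(** The vertices at which the exponent [b] can be lowered by one without leaving the
    ideal. *)
Definition free_vertices : {set 'I_n} :=
  [set u | (0 < b u)%N && [forall v, G u v ==> (b u + b v != k)%N]].

(** Along such an edge the two ends cannot both be lowered by one. *)
Definition critical_edge : rel 'I_n := fun u v => G u v && (b u + b v == k.+1)%N.

Lemma upper_koszul_independence :
  upper_koszul (symbolic_exponent k) b =i independence_complex critical_edge free_vertices.
Proof.
move=> t; apply/andP/independence_complexP.
  move=> [/mnm_lepP tb /symbolic_exponentP Ht]; split.
    apply/subsetP=> u ut; rewrite inE; apply/andP; split.
      by have := tb u; rewrite mnmE ut.
    apply/forallP=> v; apply/implyP=> Guv; have := Ht _ _ Guv.
    have := tb u; rewrite !mnmE ut; lia.
  move=> u v ut vt; apply/andP=> -[Guv /eqP bE]; have := Ht _ _ Guv.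
  have := tb u; have := tb v; rewrite !mnmE ut vt; lia.
move=> [/subsetP tU ind]; split.
  apply/mnm_lepP=> u; rewrite mnmE; case ut: (u \in t) => //.
  by have := tU u ut; rewrite inE => /andP[].
apply/symbolic_exponentP=> u v Guv; rewrite !mnmE.
have Gvu : G v u by rewrite adj_sym.
have := symbolic_exponentP _ _ b_sym u v Guv.
have free x y : G x y -> x \in t -> (0 < b x)%N /\ (b x + b y)%N <> k.
  move=> Gxy xt; have := tU x xt; rewrite inE => /andP[bx /forallP/(_ y)].
  by rewrite Gxy => /eqP.
case ut: (u \in t); case vt: (v \in t) => /=.
- have [] := free _ _ Guv ut; have [] := free _ _ Gvu vt.
  have := ind u v ut vt; rewrite /critical_edge Guv /=; lia.
- have [] := free _ _ Guv ut; lia.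
- have [] := free _ _ Gvu vt; lia.
- lia.
Qed.

End DegreeComplex.

Section Bound.
Variables (m : nat) (b : 'X_{1..n}).
Hypothesis b_sym : symbolic_exponent m.*2 b.
Let W := free_vertices m.*2 b.
Let e := critical_edge m.*2 b.
Hypothesis no_cone : {in W, forall u, exists2 v, v \in W & e u v}.
Variable B : {set 'I_n}.
Hypothesis BW : {in B, forall u, u \in W /\ (b u <= m)%N}.

(** Letting the vertices of [B] enter one level early puts their [e]-neighbours
    into the neighbourhood one level early as well. *)
Definition level_set t : {set 'I_n} :=
  [set u | (b u <= t)%N || ((u \in B) && (b u == t.+1))].

Let freeW u v : u \in W -> G u v -> (b u + b v)%N <> m.*2.
Proof. by rewrite inE => /andP[_ /forallP/(_ v)] + Guv; rewrite Guv => /eqP. Qed.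

(** Two adjacent vertices of the level set satisfy [b_u + b_v >= 2m] with both
    values at most [t + 1 <= m], so both equal [m] and lie in [B], while a free
    vertex is on no edge of weight [2m]. *)
Lemma independent_level_set t : (t < m)%N -> independent G (level_set t).
Proof.
move=> tm; apply/forall_inP=> u; rewrite inE => Hu; apply/forall_inP=> v; rewrite inE => Hv.
apply/negP=> Guv; have := symbolic_exponentP _ _ b_sym u v Guv.
case/orP: Hu => [|/andP[/BW[uW _] /eqP]] ; first by case/orP: Hv => [|/andP[_ /eqP]]; lia.
have := freeW uW Guv; case/orP: Hv => [|/andP[_ /eqP]]; lia.
Qed.

Let P := W :\: [set u | (b u <= m)%N].

Lemma sum_level_sets : (\sum_(t < m) #|level_set t| = \sum_u (m - b u) + #|B|)%N.
Proof.
rewrite sum_card (card_sum_mem B) -big_split.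
apply: eq_bigr => u _ /=.
transitivity (\sum_(t < m) ((b u <= t) + ((u \in B) && (t == (b u).-1 :> nat))))%N.
  apply: eq_bigr => t _; rewrite inE; case uB: (u \in B) => /=; last by rewrite orbF addn0.
  have [uW _] := BW uB; move: uW; rewrite inE => /andP[bu _]; lia.
rewrite big_split /= sum_threshold; congr addn; case uB: (u \in B) => /=; last by rewrite big1.
have [uW bum] := BW uB; move: uW; rewrite inE => /andP[bu _].
have lt : ((b u).-1 < m)%N by lia.
rewrite (bigD1 (Ordinal lt)) //= eqxx big1 // => t; rewrite -val_eqE /= => /negPf ->.
by [].
Qed.

(** A vertex with [b_u > m] has value [2m - c] with [c < m], and enters the
    neighbourhood of the level sets for all [t > c]: it has a neighbour of value
    [c], or else is free and has an [e]-neighbour of value [c + 1].  At the level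
    [t = c] it is missed only in the second case, and then only if no
    [e]-neighbour is in [B]; these misses are paid for by the last term. *)
Lemma sum_level_nbhds :
  (\sum_u (b u - m) <= \sum_(t < m) #|nbhd G (level_set t)| + #|P :\: enbhd e B|)%N.
Proof.
rewrite sum_card (card_sum_mem (P :\: _)) -big_split.
apply: leq_sum => u _ /=.
have [/eqP ->//|bum] : (b u - m == 0)%N \/ (m < b u)%N by lia.
suff [c bc [Hlt Heq]] : exists2 c, (b u + c = m.*2)%N &
   (forall t, (c < t)%N -> u \in nbhd G (level_set t)) /\
   (u \notin P :\: enbhd e B -> u \in nbhd G (level_set c)).
  have -> : (b u - m = \sum_(t < m) (c <= t))%N by rewrite sum_threshold; lia.
  have [_|/Heq uc] := boolP (u \in P :\: _).
    apply: leq_trans (leq_add (leqnn _) (sum_point m c)); rewrite -big_split.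
    apply: leq_sum => t _ /=; have [lt|] := ltnP c t; first by rewrite Hlt // (ltnW lt).
    by case: (_ \in _); case: eqP; lia.
  rewrite addn0; apply: leq_sum => t _.
  by have [/Hlt ->|//|<-] := ltngtP c t; rewrite ?uc.
have nbhdP v t : G u v -> v \in level_set t -> u \in nbhd G (level_set t).
  by move=> Guv vt; rewrite inE; apply/exists_inP; exists v => //; rewrite adj_sym.
case uW: (u \in W); last first.
  move: uW; rewrite inE; have -> /= : (0 < b u)%N by lia.
  case/forallPn=> v; rewrite negb_imply negbK => /andP[Guv /eqP bE].
  exists (b v) => //; split=> [t lt|_]; apply: (nbhdP v) => //; rewrite inE ?leqnn //.
  by rewrite ltnW.
have [v vW /andP[Guv /eqP bE]] := no_cone uW.
have bv : (0 < b v)%N by move: vW; rewrite inE => /andP[].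
exists (b v).-1; first lia.
split=> [t lt|]; first by apply: (nbhdP v) => //; rewrite inE; apply/orP; left; lia.
have uP : u \in P by rewrite in_setD uW inE -ltnNge bum.
rewrite in_setD uP andbT negbK inE => /exists_inP[w wB] /andP[Gwu /eqP bE'].
apply: (nbhdP w); first by rewrite adj_sym.
by rewrite inE wB /=; apply/orP; right; apply/eqP; lia.
Qed.

(** Weighing [n + |N(C_t)| <= g + |C_t|] over all thresholds [t] and using
    [b_u = m + (b_u - m) - (m - b_u)], with truncated differences. *)
Lemma mdeg_bound g : (forall A, independent G A -> n + #|nbhd G A| <= g + #|A|)%N ->
  (mdeg b <= #|P :\: enbhd e B| + #|B| + m * g)%N.
Proof.
move=> Hg; have : (\sum_(t < m) (n + #|nbhd G (level_set t)|) <=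
    \sum_(t < m) (g + #|level_set t|))%N.
  by apply: leq_sum => t _; apply/Hg/independent_level_set.
rewrite !big_split /= !sum_nat_const !card_ord sum_level_sets.
have := sum_level_nbhds.
have -> : mdeg b = (n * m + \sum_u (b u - m) - \sum_u (m - b u))%N.
  have : (mdeg b + \sum_u (m - b u) = n * m + \sum_u (b u - m))%N.
    rewrite mdegE -big_split -[n in (n * m)%N]card_ord -sum_nat_const -big_split.
    by apply: eq_bigr => u _ /=; lia.
  lia.
rewrite mulnC; move: (\sum_u (b u - m))%N (\sum_u (m - b u))%N (\sum_(t < m) _)%N.
move: #|P :\: _| #|B| (n * m)%N (m * g)%N; lia.
Qed.

End Bound.

(** The topological heart of the bound.  The parity of the exponent [m.*2] makes
    the vertices of value at most [m] a vertex cover of the critical edges. *)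
Lemma acyclic_upper_koszul (K : fieldType) m g p b :
  (forall A, independent G A -> n + #|nbhd G A| <= g + #|A|)%N ->
  (p + m * g < mdeg b)%N ->
  acyclic_at K (upper_koszul (symbolic_exponent m.*2) b) p.
Proof.
move=> Hg ltp; have [b_sym|b_nsym] := boolP (symbolic_exponent m.*2 b); last first.
  apply: acyclic_void => t /andP[_ /symbolic_exponentP H]; case/negP: b_nsym.
  apply/symbolic_exponentP=> u v /H; rewrite !mnmE; lia.
apply: eq_acyclic (fun t => esym (upper_koszul_independence b_sym t)) _.
set W := free_vertices _ _; set e := critical_edge _ _.
have e_sym : ssrbool.symmetric e by move=> u v; rewrite /e /critical_edge adj_sym addnC.
have e_irr : ssrbool.irreflexive e by move=> u; rewrite /e /critical_edge adj_irr.
have [/existsP[u /andP[uW /exists_inPn nu]]|noc] :=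
  boolP [exists u, (u \in W) && ~~ [exists v in W, e u v]].
  apply: (acyclic_cone (u := u)) => t /independence_complexP[tW ind] _.
  apply/independence_complexP; split; first by rewrite subUset sub1set uW.
  move=> x y /setU1P[->|xt] /setU1P[->|yt]; first by rewrite e_irr.
  - by apply/nu/(subsetP tW).
  - by rewrite e_sym; apply/nu/(subsetP tW).
  exact: ind.
have no_cone : {in W, forall u, exists2 v, v \in W & e u v}.
  by move=> u uW; move/existsPn: noc => /(_ u); rewrite uW negbK => /exists_inP.
pose Q := W :&: [set u | (b u <= m)%N].
have PE : W :\: Q = W :\: [set u | (b u <= m)%N] by rewrite /Q setDIr setDv set0U.
apply: (acyclic_independence e_sym e_irr (Q := Q)); first exact: subsetIl.
  rewrite PE => u v; rewrite !inE -!ltnNge => /andP[bu _] /andP[bv _].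
  by rewrite /e /critical_edge; apply/negP=> /andP[_ /eqP]; lia.
move=> C /subsetP CQ; rewrite PE.
have CW : {in C, forall u, u \in W /\ (b u <= m)%N}.
  by move=> u /CQ /setIP[uW]; rewrite inE.
have := mdeg_bound b_sym no_cone CW Hg; rewrite -/W -/e; lia.
Qed.

End CoverIdeal.

(** * Independent sets and the invariant gamma0 *)

(** The first step of a path to another vertex of the component. *)
Lemma component_has_nbr (T : finType) (H : sgraph T) (C : {set T}) x :
  C \in components H -> x \in C -> #|C| != 1%N ->
  exists2 y, y \in C & H x y.
Proof.
case/imsetP=> z _ -> ; rewrite inE => zx C1.
have csym : connect_sym H by apply: sym_connect_sym => ? ?; rewrite adj_sym.
have [y] : exists2 y, connect H z y & y != x.
  apply/exists_inP; apply: contraNT C1 => /exists_inPn H1.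
  apply/eqP; rewrite -(cards1 x); congr #|pred_of_set _|; apply/setP=> y.
  rewrite !inE; apply/idP/eqP => [/H1|->//]; by rewrite negbK => /eqP.
move=> zy yx; have : connect H x y by rewrite csym in zx; apply: connect_trans zx zy.
case/connectP=> -[|w p] /=; first by move=> _ E; rewrite E eqxx in yx.
case/andP=> xw _ _; exists w => //; rewrite inE.
exact: connect_trans zx (connect1 xw).
Qed.

Section Gamma0.
Variables (T : finType) (G : sgraph T).
Implicit Types A : {set T}.

Lemma nbhdP A y : reflect (exists2 x, x \in A & G x y) (y \in nbhd G A).
Proof. by rewrite inE; apply: exists_inP. Qed.

Lemma independentP A : reflect {in A &, forall x y, ~~ G x y} (independent G A).
Proof.
apply: (iffP forall_inP) => [H x y xA yA|H x xA]; last by apply/forall_inP=> y; apply: H.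
by have /forall_inP := H x xA; apply.
Qed.

(** A component [C] of [G \ N[A]] that violates admissibility is bipartite with
    more than one vertex, hence without isolated vertices.  Adding its smaller
    class [C1'] to [A] brings the other class [C2] into the neighbourhood. *)
Lemma enlarge_independent A : independent G A -> ~~ gamma0_admissible G A ->
  exists A', [/\ independent G A', (#|A| < #|A'|)%N
    & (#|nbhd G A| + #|A'| <= #|nbhd G A'| + #|A|)%N].
Proof.
move=> indA; rewrite /gamma0_admissible indA /= => /forall_inPn[C CH].
rewrite negb_imply => /andP[/existsP[B0 colB0] C1].
set N := closed_nbhd G A in C CH B0 colB0 C1; set H := delete G N in CH colB0 C1.
have {colB0} colB0 x y : x \in C -> y \in C -> G (val x) (val y) -> (x \in B0) != (y \in B0).
  by move=> xC yC Gxy; have /forall_inP/(_ x xC)/forall_inP/(_ y yC)/implyP := colB0; apply.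
wlog leB : B0 colB0 / (#|C :&: B0| <= #|C :\: B0|)%N => [IH|].
  have [|/ltnW leB] := leqP #|C :&: B0| #|C :\: B0|; first exact: IH.
  apply: (IH (~: B0)); last by rewrite -setDE [X in (_ <= #|pred_of_set X|)%N]setDE setCK.
  by move=> x y xC yC Gxy; rewrite !inE (inj_eq negb_inj) colB0.
pose C1' := [set val x | x in C :&: B0]; pose C2 := [set val x | x in C :\: B0].
have notN (x : {x | x \notin N}) : val x \notin N := valP x.
have disA : [disjoint A & C1'].
  rewrite disjoint_subset; apply/subsetP=> x xA; rewrite inE; apply/negP=> /imsetP[y _ xy].
  by have := notN y; rewrite -xy inE xA orbT.
have subN : nbhd G A :|: C2 \subset nbhd G (A :|: C1').
  rewrite subUset; apply/andP; split; apply/subsetP=> y.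
    by case/nbhdP=> x xA Gxy; apply/nbhdP; exists x; rewrite // inE xA.
  case/imsetP=> z /setDP[zC zB] ->; have [w wC Hzw] := component_has_nbr CH zC C1.
  apply/nbhdP; exists (val w); last by rewrite adj_sym.
  rewrite inE; apply/orP; right; apply: imset_f; rewrite inE wC /=.
  by have := colB0 z w zC wC Hzw; rewrite (negPf zB); case: (w \in B0).
have disN : [disjoint nbhd G A & C2].
  rewrite disjoint_subset; apply/subsetP=> x xA; rewrite inE; apply/negP=> /imsetP[y _ xy].
  by have := notN y; rewrite -xy inE xA.
have cC1 : #|C1'| = #|C :&: B0| by apply: card_imset; apply: val_inj.
have cC2 : #|C2| = #|C :\: B0| by apply: card_imset; apply: val_inj.
have C1_gt0 : (0 < #|C :&: B0|)%N.
  case/imsetP: (CH) => x _ CE; have xC : x \in C by rewrite CE inE connect0.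
  have [y yC Hxy] := component_has_nbr CH xC C1.
  have := colB0 x y xC yC Hxy; rewrite card_gt0 => neq; apply/set0Pn.
  by case xB: (x \in B0) neq => neq; [exists x|exists y];
    rewrite inE ?xC ?xB ?yC //; case: (y \in B0) neq.
have cU : #|A :|: C1'| = (#|A| + #|C1'|)%N by rewrite cardsU disjoint_setI0 // cards0 subn0.
exists (A :|: C1'); split.
- apply/independentP=> x y /setUP[xA|xC] /setUP[yA|yC].
  + by move/independentP: indA; apply.
  + case/imsetP: yC => z _ ->; apply/negP=> Gxz; have := notN z.
    by rewrite inE negb_or => /andP[/nbhdP[]]; exists x.
  + case/imsetP: xC => z _ ->; apply/negP=> Gxz; have := notN z.
    by rewrite inE negb_or => /andP[/nbhdP[]]; exists y; rewrite // adj_sym.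
  case/imsetP: xC => z /setIP[zC zB] ->; case/imsetP: yC => w /setIP[wC wB] ->.
  by apply/negP=> /(colB0 z w zC wC); rewrite zB wB.
- rewrite cU cC1; lia.
have := subset_leq_card subN.
rewrite cardsU disjoint_setI0 // cards0 subn0 cU cC1 cC2; lia.
Qed.

(** The enlargement strictly increases the size of the set, so it stops. *)
Lemma admissible_dominates A : independent G A ->
  exists2 A', gamma0_admissible G A' & (#|nbhd G A| + #|A'| <= #|nbhd G A'| + #|A|)%N.
Proof.
have [m] := ubnP (#|T| - #|A|)%N; elim: m A => // m IHm A leA indA.
have [admA|nadm] := boolP (gamma0_admissible G A); first by exists A.
have [A1 [indA1 ltA le1]] := enlarge_independent indA nadm.
have [|A' admA' le'] := IHm A1 _ indA1; first by have := max_card A1; lia.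
by exists A' => //; lia.
Qed.

(** The even factor absorbs the denominator 2 of the terms of [gamma0], which
    leaves a bound between natural numbers. *)
Lemma nbhd_gamma0 m (c : rat) : m.*2%:R * gamma0 G < c ->
  exists2 g, (m * g)%N%:R < c &
    forall A, independent G A -> (#|T| + #|nbhd G A| <= g + #|A|)%N.
Proof.
move=> ltc; pose h A := (#|T| + #|nbhd G A| - #|A|)%N.
exists (\max_(A | gamma0_admissible G A) h A)%N; last first.
  move=> A /admissible_dominates[A' admA' le].
  have := leq_bigmax_cond (F := h) A' admA'; rewrite /h; have := max_card A'; lia.
apply: le_lt_trans ltc; rewrite -muln2 !natrM -mulrA ler_wpM2l ?ler0n //.
elim/big_ind: _ => [|x y|A admA].
- by rewrite mulr_ge0 // /gamma0 bigmax_ge_id.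
- by move=> ? ?; rewrite natr_max ge_max; apply/andP.
have Ec : (h A)%:R / 2%:R <= gamma0 G.
  rewrite /h natrB ?natrD; last by rewrite (leq_trans (max_card _)) ?leq_addr.
  exact: (le_bigmax_cond _ (fun A : {set T} => (#|T|%:R + #|nbhd G A|%:R - #|A|%:R) / 2%:R) admA).
by rewrite -ler_pdivrMl // mulrC.
Qed.

End Gamma0.

(** * Koszul homology of monomial ideals *)

Section MonomialKoszul.
Variables (K : fieldType) (n : nat).
Local Notation S := {mpoly K[n]}.
Implicit Types (s t : {set 'I_n}) (b m : 'X_{1..n}) (z : {set 'I_n} -> S^o).
Local Notation vars := (fun u : 'I_n => 'X_u : S).
Local Notation boundary := (@koszul n K K^o (fun=> 1)).

Lemma mcoeffXM (f : S) u m :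
  ('X_u * f)@_m = if (U_(u) <= m)%MM then f@_(m - U_(u)) else 0.
Proof.
rewrite mulrC; case: ifP => um; first by rewrite -{1}(submK um) addmC mcoeffMX.
apply/eqP; rewrite mcoeff_eq0; apply: contraFN um => /msuppM_le/allpairsP[[m1 m2] /= [_ + ->]].
by rewrite msuppX inE => /eqP ->; apply: lem_addl.
Qed.

(** The simplicial chain formed by the coefficients of [z] in multidegree [b],
    where the exterior variable [e_t] carries the multidegree of [t]. *)
Definition strand z b : {set 'I_n} -> K^o :=
  fun t => if (indicator_mnm t <= b)%MM then (z t)@_(b - indicator_mnm t) else 0.

Lemma indicator_mnmU1 u s : u \notin s ->
  indicator_mnm (u |: s) = (U_(u) + indicator_mnm s)%MM.
Proof.
move=> us; apply/mnmP=> i; rewrite !mnmE in_setU1 eq_sym.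
by case: eqP => // <-; rewrite (negPf us).
Qed.

Lemma mdeg_indicator t : mdeg (indicator_mnm t) = #|t|.
Proof. by rewrite mdegE card_sum_mem; apply: eq_bigr => i _; rewrite mnmE. Qed.

Lemma strand_koszul z b s : strand (koszul vars z) b s = boundary (strand z b) s.
Proof.
rewrite /strand; case: ifP => sb; last first.
  rewrite koszul0 // => u us; case: ifP => // usb.
  by move: usb; rewrite indicator_mnmU1 // => /(lepm_trans (lem_addl _ _)); rewrite sb.
rewrite /koszul raddf_sum; apply: eq_bigr => u us.
rewrite mulr1 /GRing.scale /= -mulrA -signr_odd mulr_sign -[in RHS]signr_odd mulr_sign.
have E : ('X_u * z (u |: s))@_(b - indicator_mnm s) =
   if (indicator_mnm (u |: s) <= b)%MM then (z (u |: s))@_(b - indicator_mnm (u |: s)) else 0.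
  rewrite mcoeffXM indicator_mnmU1 //.
  have -> : (U_(u) <= b - indicator_mnm s)%MM = (U_(u) + indicator_mnm s <= b)%MM.
    apply/mnm_lepP/mnm_lepP => H i; have := H i; have := mnm_lepP sb i;
    rewrite ?mnmBE ?mnmDE; lia.
  by case: ifP => // _; congr mcoeff; apply/mnmP=> i; rewrite !mnmBE mnmDE; lia.
by case: (odd _); rewrite ?mcoeffN E.
Qed.

Lemma strand_add z s m : strand z (m + indicator_mnm s) s = (z s)@_m.
Proof. by rewrite /strand lem_addl addmK. Qed.

(** Membership in the degree [j] part of the [p]-th term of the Koszul complex of
    the monomial ideal with exponents in [P].  The degree is an integer because
    shifted free modules are treated component by component. *)
Definition koszul_chain (P : pred 'X_{1..n}) p (j : int) z :=
  forall t m, m \in msupp (z t) -> [/\ P m, #|t| = p & (mdeg m + p)%:Z = j].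

Lemma strand_chain P p j z b : koszul_chain P p j z ->
  chain_on (upper_koszul P b) p (strand z b).
Proof.
move=> zP t; rewrite /strand; case: ifP => [tb|]; last by rewrite eqxx.
rewrite -mcoeff_msupp => /zP[Pm -> _]; rewrite eqxx andbT unfold_in.
by apply/andP.
Qed.

Lemma strand_degree P p j z b t : koszul_chain P p j z -> strand z b t != 0 -> (mdeg b)%:Z = j.
Proof.
move=> zP; rewrite /strand; case: ifP => [tb|]; last by rewrite eqxx.
rewrite -mcoeff_msupp => /zP[_ tp <-]; congr Posz.
by rewrite -{1}(submK tb) mdegD mdeg_indicator tp.
Qed.

(** Solve [boundary F = strand z] in each multidegree of total degree [j], of
    which there are finitely many, and reassemble the solutions. *)
Lemma koszul_exact P p j z :
  (forall b, (mdeg b)%:Z = j -> acyclic_at K (upper_koszul P b) p) ->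
  koszul_chain P p j z -> (forall s, koszul vars z s = 0) ->
  exists2 y, koszul_chain P p.+1 j y & forall s, koszul vars y s = z s.
Proof.
move=> acP zP dz.
have [F FP] : exists F : 'X_{1..n} -> {set 'I_n} -> K^o, forall b,
   [/\ chain_on (upper_koszul P b) p.+1 (F b),
       forall t, boundary (F b) t = strand z b t
     & forall t, F b t != 0 -> (mdeg b)%:Z = j].
  have F0 b : (mdeg b)%:Z <> j ->
      [/\ chain_on (upper_koszul P b) p.+1 (fun=> 0),
          forall t, boundary (fun=> 0) t = strand z b t
        & forall t, (0 : K) != 0 -> (mdeg b)%:Z = j].
    move=> bj; split=> [t|t|t]; rewrite ?eqxx //.
    by rewrite koszul0 //; have [->//|/(strand_degree zP)] := eqVneq (strand z b t) 0.
  have /fin_all_exists[F FP] : forall b : 'X_{1..n < `|j|.+1}, exists F : {set 'I_n} -> K^o,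
   [/\ chain_on (upper_koszul P b) p.+1 F,
       forall t, boundary F t = strand z b t
     & forall t, F t != 0 -> (mdeg b)%:Z = j].
    move=> b; have [bj|bj] := eqVneq (mdeg b)%:Z j; last first.
      by exists (fun=> 0); apply: F0; apply/eqP.
    have [||F] := acP b bj (strand z b); [exact: strand_chain zP| |by exists F].
    by move=> t; rewrite -strand_koszul /strand dz mcoeff0 if_same.
  exists (fun b => oapp F (fun=> 0) (insub b)) => b.
  case: insubP => [b' _ <-|bj]; first exact: FP.
  by apply: F0 => E; rewrite -E /= ltnS leqnn in bj.
pose y t : S^o := \sum_(b : 'X_{1..n < `|j|.+1}) F b t *: 'X_[b - indicator_mnm t].
have Fle b t : F b t != 0 -> (indicator_mnm t <= b)%MM.
  by have [Fc _ _] := FP b => /Fc/andP[/andP[]].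
have yE b t : strand y b t = F b t.
  rewrite /strand; case: ifP => tb; last first.
    by have [->//|/Fle] := eqVneq (F b t) 0; rewrite tb.
  rewrite raddf_sum.
  have term (c : 'X_{1..n < `|j|.+1}) :
     (F c t *: 'X_[c - indicator_mnm t] : S)@_(b - indicator_mnm t)
       = if bmnm c == b then F b t else 0.
    rewrite mcoeffZ mcoeffX; have [Fc0|/Fle tc] := eqVneq (F c t) 0.
      by rewrite Fc0 mul0r; case: (eqVneq (bmnm c) b) => // <-; rewrite Fc0.
    suff -> : (c - indicator_mnm t == b - indicator_mnm t)%MM = (bmnm c == b).
      by case: eqP => [->|]; rewrite ?mulr1 ?mulr0.
    by apply/eqP/eqP => [/(congr1 (fun m => m + indicator_mnm t)%MM)|->//]; rewrite !submK.
  rewrite (eq_bigr _ (fun c _ => term c)) -big_mkcond.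
  have [F0|Fn0] := eqVneq (F b t) 0; first by rewrite big1.
  have [_ _ /(_ t Fn0) bj] := FP b.
  have lt : (mdeg b < `|j|.+1)%N by rewrite -bj ltnS.
  by rewrite (big_pred1 (BMultinom lt)).
exists y.
  move=> t m; rewrite mcoeff_msupp -strand_add yE => Fn0.
  have [Fc _ /(_ t Fn0) <-] := FP (m + indicator_mnm t)%MM.
  have /andP[/andP[_ Pm] /eqP tp] := Fc t Fn0.
  by rewrite addmK in Pm; rewrite mdegD mdeg_indicator tp.
move=> s; apply/mpolyP=> m; rewrite -!strand_add strand_koszul.
by rewrite (eq_koszul _ _ (yE _)); have [_ ->] := FP (m + indicator_mnm s)%MM.
Qed.

End MonomialKoszul.

(** * From minimal resolutions to Koszul cycles *)

Section Chase.
Variables (K : fieldType) (n : nat).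
Local Notation S := {mpoly K[n]}.
Local Notation vars := (fun u : 'I_n => 'X_u : S).
Implicit Types (s t : {set 'I_n}) (p : nat) (j : int).

(** For the whole polynomial ring the complex is the full simplex on the support
    of [b]. *)
Lemma acyclic_upper_koszul_free p (b : 'X_{1..n}) : b != 0%MM ->
  acyclic_at K (upper_koszul predT b) p.
Proof.
move=> bn0; have [u bu] : exists u, (0 < b u)%N.
  apply/existsP; apply: contraNT bn0 => /existsPn b0; apply/eqP/mnmP=> u.
  by rewrite mnmE; apply/eqP; rewrite -leqn0 leqNgt b0.
apply: (acyclic_cone (u := u)) => t /andP[/mnm_lepP tb _] ut; rewrite unfold_in /= andbT.
apply/mnm_lepP=> i; rewrite mnmE in_setU1; case: eqP => [->|_] //=.
by have := tb i; rewrite mnmE.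
Qed.

(** As [koszul_chain], for the graded free module with shifts [sh]. *)
Definition graded_chain a (sh : 'I_a -> int) p j (z : {set 'I_n} -> 'rV[S]_a) :=
  forall t r m, m \in msupp (z t 0 r) -> #|t| = p /\ sh r + (mdeg m + p)%:Z = j.

Lemma koszul_entry a (z : {set 'I_n} -> 'rV[S]_a) r s :
  koszul vars z s 0 r = koszul vars (fun t => z t 0 r : S^o) s.
Proof. by rewrite /koszul summxE; apply: eq_bigr => u _; rewrite mxE. Qed.

Lemma koszul_mulmx a b (z : {set 'I_n} -> 'rV[S]_a) (D : 'M[S]_(a, b)) s :
  koszul vars (fun t => z t *m D) s = koszul vars z s *m D.
Proof. by rewrite /koszul mulmx_suml; apply: eq_bigr => u _; rewrite scalemxAl. Qed.

(** The Koszul complex of a free module is exact except for its homology [K^a] in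
    position 0.  The condition on constant coefficients kills that homology, and
    for [p > 0] it holds automatically. *)
Lemma koszul_free_exact a (sh : 'I_a -> int) p j (z : {set 'I_n} -> 'rV[S]_a) :
  graded_chain sh p j z -> (forall s, koszul vars z s = 0) ->
  (forall r, (z set0 0 r)@_0 = 0) ->
  exists2 y, graded_chain sh p.+1 j y & forall s, koszul vars y s = z s.
Proof.
move=> zg dz z0.
have /fin_all_exists[y yP] : forall r, exists y : {set 'I_n} -> S^o,
    koszul_chain predT p.+1 (j - sh r) y /\ forall s, koszul vars y s = z s 0 r.
  move=> r; have zr : koszul_chain predT p (j - sh r) (fun t => z t 0 r : S^o).
    by move=> t m /zg[-> <-]; split=> //; rewrite addrC addKr.
  have [j0|jn0] := eqVneq (j - sh r) 0.
    have zr0 s : z s 0 r = 0.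
      apply/mpolyP=> m; rewrite mcoeff0; apply/eqP; rewrite mcoeff_eq0; apply/negP=> mz.
      have [_ sp] := zr s m mz; rewrite j0 => -[/eqP]; rewrite addn_eq0 mdeg_eq0.
      case/andP=> /eqP m0 /eqP p0; move: mz; rewrite m0 mcoeff_msupp.
      by rewrite (cards0_eq (etrans sp p0)) z0 eqxx.
    exists (fun=> 0); split=> [t m|s]; first by rewrite msupp0.
    by rewrite zr0 koszul0.
  have [||y yc yd] := koszul_exact (P := predT) _ zr; last by exists y.
  - move=> b bj; apply: acyclic_upper_koszul_free; apply: contraNneq jn0 => b0.
    by rewrite -bj b0 mdeg0.
  - by move=> s; rewrite -koszul_entry dz mxE.
exists (fun t => \row_r y r t).
  move=> t r m; rewrite mxE => /(proj1 (yP r))[_ -> ->]; split=> //.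
  by rewrite addrC subrK.
move=> s; apply/rowP=> r; rewrite koszul_entry -(proj2 (yP r)).
by rewrite (@eq_koszul _ _ _ _ _ (y r)) // => t; rewrite mxE.
Qed.

(** The part of the Koszul homology of the submodule [M] in position [p] and
    degree [j] that dies in the ambient free module vanishes; for [p > 0] this is
    all of it. *)
Definition koszul_vanishing a (sh : 'I_a -> int) (M : 'rV[S]_a -> Prop) p j :=
  forall z, graded_chain sh p j z -> (forall t, M (z t)) ->
  (forall s, koszul vars z s = 0) -> (forall r, (z set0 0 r)@_0 = 0) ->
  exists2 y, (forall t, M (y t)) & forall s, koszul vars y s = z s.

Lemma koszul_vanishing_iff a (sh : 'I_a -> int) (M M' : 'rV[S]_a -> Prop) p j :
  (forall v, M v <-> M' v) -> koszul_vanishing sh M p j -> koszul_vanishing sh M' p j.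
Proof.
move=> MM' VM z zg zM dz z0; have [||||y yM dy] := VM z => //; first by move=> t; apply/MM'.
by exists y => // t; apply/MM'.
Qed.

Definition graded_matrix a b (sa : 'I_a -> int) (sb : 'I_b -> int) (D : 'M[S]_(a, b)) :=
  forall r c m, m \in msupp (D r c) -> sa r = sb c + (mdeg m)%:Z.

Lemma graded_chain_mulmx a b (sa : 'I_a -> int) (sb : 'I_b -> int) (D : 'M[S]_(a, b)) p j z :
  graded_matrix sa sb D -> graded_chain sa p j z -> graded_chain sb p j (fun t => z t *m D).
Proof.
move=> gD gz t c m; rewrite mxE => /msupp_sum_le/flattenP[_ /mapP[r _ ->]].
move/msuppM_le/allpairsP=> [[m1 m2] /= [/gz[-> <-] /gD -> ->]]; split=> //.
rewrite mdegD -addnA !PoszD; ring.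
Qed.

(** Dimension shifting along [0 -> ker D -> S^a -> im D -> 0]: a cycle [z] of
    [ker D] bounds some [y] over the free module, the image [y D] is a cycle of
    [im D] one position higher, and correcting [y] by a lift of the chain it
    bounds yields a chain of [ker D] with boundary [z]. *)
Lemma koszul_vanishing_ker a b (sa : 'I_a -> int) (sb : 'I_b -> int) (D : 'M[S]_(a, b)) p j :
  graded_matrix sa sb D ->
  koszul_vanishing sb (fun v => exists u, v = u *m D) p.+1 j ->
  koszul_vanishing sa (fun u => u *m D = 0) p j.
Proof.
move=> gD Vim z zg zD dz z0; have [y yg dy] := koszul_free_exact zg dz z0.
have [||||w wD dw] := Vim (fun t => y t *m D).
- exact: graded_chain_mulmx gD yg.
- by move=> t; exists (y t).
- by move=> s; rewrite koszul_mulmx dy zD.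
- move=> c; apply/eqP; rewrite mcoeff_eq0; apply/negP.
  by move=> /(graded_chain_mulmx gD yg)[]; rewrite cards0.
have /fin_all_exists[w' w'E] := wD.
exists (fun t => y t - koszul vars w' t) => [t|s].
  rewrite mulmxBl -koszul_mulmx (eq_koszul _ _ (fun t => esym (w'E t))) dw; exact: subrr.
by rewrite koszulB dy koszul_sq subr0.
Qed.

(** If the image of a basis vector were in the maximal ideal times [im D], the
    basis vector would agree modulo the maximal ideal with an element of [ker D],
    contrary to minimality. *)
Lemma row_not_koszul_boundary a b c (D : 'M[S]_(a, b)) (E : 'M[S]_(c, a)) (r : 'I_a) :
  (forall u : 'rV_a, u *m D = 0 -> exists v, u = v *m E) -> (forall i, (E i r)@_0 = 0) ->
  ~ exists2 y : {set 'I_n} -> 'rV[S]_b, (forall t, exists u, y t = u *m D) &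
      koszul vars y set0 = row r D.
Proof.
move=> kerD minE [y /fin_all_exists[u uE] dy].
have [|v /rowP/(_ r)] := kerD (delta_mx 0 r - koszul vars u set0).
  by rewrite mulmxBl -koszul_mulmx -(eq_koszul _ _ uE) dy -rowE subrr.
rewrite !mxE !eqxx /= => /(congr1 (mcoeff 0%MM)).
rewrite mcoeffB mcoeff1 eqxx koszul_entry /koszul !raddf_sum /= !big1 ?addr0.
- by move/eqP; rewrite oner_eq0.
- by move=> i _; rewrite rmorphM /= minE mulr0.
move=> i _; rewrite /GRing.scale /= !rmorphM /= mcoeffX.
by rewrite -mdeg_eq0 mdeg1 mulr0 mul0r oppr0.
Qed.

(** A generator of the [i]-th module is a nonzero class of position 0 for the
    [i]-th syzygy module; dimension shifting moves it to position [i] for [I]. *)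
Lemma resolution_generator (F : free_sequence K n) (I : S -> Prop) i (r : 'I_(rank F i)) :
  minimal_graded_free_resolution F I ->
  (forall z : {set 'I_n} -> S^o, (forall t, I (z t)) ->
     (forall t m, m \in msupp (z t) -> #|t| = i /\ (mdeg m + i)%:Z = shift r) ->
     (forall s, koszul vars z s = 0) ->
     exists2 y : {set 'I_n} -> S^o, (forall t, I (y t)) & forall s, koszul vars y s = z s) ->
  False.
Proof.
case=> -[g0 gS] [Iaug ker0 kerS] minF VI.
have [j jE] : exists j, shift r = j by exists (shift r).
rewrite jE in VI.
have imI (v : 'rV[S]_1) : I (v 0 0) <-> exists u, v = u *m aug F.
  split=> [/Iaug[u E]|[u ->]]; last by apply/Iaug; exists u.
  by exists u; apply/rowP=> c; rewrite !ord1.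
have gaug : graded_matrix (@shift _ _ F 0) (fun _ : 'I_1 => 0) (aug F).
  by move=> r' c m; rewrite ord1 add0r; apply: g0.
have gdiff q : graded_matrix (@shift _ _ F q.+1) (@shift _ _ F q) (diff F q).
  by move=> r' c m; apply: gS.
(* [aug F] has values in row vectors of length 1, so the polynomials of [I] are
   viewed as such vectors. *)
have toI (z : {set 'I_n} -> 'rV[S]_1) : graded_chain (fun=> 0) i j z ->
    (forall t, I (z t 0 0)) -> (forall s, koszul vars z s = 0) ->
    exists2 y : {set 'I_n} -> 'rV[S]_1, (forall t, I (y t 0 0)) &
      forall s, koszul vars y s = z s.
  move=> zg zI dz; have [||y yI dy] := VI (fun t => z t 0 0) zI.
  - by move=> t m /zg[-> <-]; rewrite add0r.
  - by move=> s; rewrite -koszul_entry dz mxE.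
  exists (fun t => (y t)%:M) => [t|s]; first by rewrite mxE eqxx mulr1n.
  apply/rowP=> c; rewrite !ord1 koszul_entry -dy.
  by rewrite (@eq_koszul _ _ _ _ _ y) // => t; rewrite mxE eqxx mulr1n.
have Vim q p : (p + q.+1)%N = i ->
    koszul_vanishing (@shift _ _ F q) (fun u => exists v, u = v *m diff F q) p j.
  elim: q p => [|q IHq] p pq.
    apply: (koszul_vanishing_iff ker0); apply: (koszul_vanishing_ker gaug).
    apply: (koszul_vanishing_iff imI) => z zg zI dz _; apply: toI => //.
    by rewrite -pq addn1.
  apply: (koszul_vanishing_iff (kerS q)); apply: (koszul_vanishing_ker (gdiff q)).
  by apply: IHq; rewrite addSnnS.
(* A module element as a Koszul chain in position 0. *)
pose single b (v : 'rV[S]_b) t : 'rV[S]_b := if t == set0 then v else 0.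
have dsingle b v s : koszul vars (@single b v) s = 0.
  apply: koszul0 => u _; rewrite /single ifN //; apply/set0Pn; exists u; exact: setU11.
have gsingle b (sb : 'I_b -> int) c (sc : 'I_c -> int) (D : 'M[S]_(c, b)) k :
    graded_matrix sc sb D -> graded_chain sb 0 (sc k) (single b (row k D)).
  move=> gD t r' m; rewrite /single; case: eqP => [->|]; last by rewrite mxE msupp0.
  by rewrite mxE cards0 addn0 => /gD ->.
case: i r jE VI toI Vim => [|i] r jE VI toI Vim.
  apply: (@row_not_koszul_boundary _ _ _ (aug F) (diff F 0) r) => [u /ker0 //| c|]; first exact: minF.
  have [||y yI dy] := toI (single 1%N (row r (aug F))) _ _ (dsingle _ _).
  - by rewrite -jE; exact: gsingle gaug.
  - move=> t; apply/imI; rewrite /single; case: eqP => _; last by exists 0; rewrite mul0mx.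
    by exists (delta_mx 0 r); rewrite -rowE.
  - by exists y; [move=> t; apply/imI | rewrite dy /single eqxx].
apply: (@row_not_koszul_boundary _ _ _ (diff F i) (diff F i.+1) r) => [u /kerS //| c|]; first exact: minF.
have [|||y yI dy] := Vim i 0%N erefl (single _ (row r (diff F i))) _ _ (dsingle _ _).
- by rewrite -jE; exact: gsingle (gdiff i).
- move=> t; rewrite /single; case: eqP => _; last by exists 0; rewrite mul0mx.
  by exists (delta_mx 0 r); rewrite -rowE.
- by move=> c; rewrite /single eqxx mxE; apply: minF.
by exists y => //; rewrite dy /single eqxx.
Qed.

End Chase.

(** * Powers of edge primes and the regularity bound *)

Section EdgePowers.
Variables (K : fieldType) (n : nat).
Local Notation S := {mpoly K[n]}.

(** Membership in the [k]-th power of the ideal generated by the [i]-th and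
    [j]-th variables, for distinct [i] and [j], read off the exponents. *)
Definition order_ge (i j : 'I_n) (k : nat) (f : S) :=
  forall m, m \in msupp f -> (k <= m i + m j)%N.

Lemma order_ge_sum i j k (A : S -> Prop) f :
  (forall g, A g -> order_ge i j k g) -> ideal_gen A f -> order_ge i j k f.
Proof.
move=> Ak [s [sA ->]] m /msupp_sum_le/flattenP[_ /mapP[p + ->]].
rewrite mem_filter /= => ps /msuppM_le/allpairsP[[m1 m2] /= [_ m2p ->]].
have := Ak _ (sA p ps) _ m2p; rewrite !mnmDE; lia.
Qed.

Lemma order_ge_edge_prime i j f : edge_prime i j f -> order_ge i j 1 f.
Proof.
apply: order_ge_sum => g -[] -> m; rewrite msuppX inE => /eqP ->; rewrite !mnmE eqxx //.
by rewrite addnC.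
Qed.

Lemma order_ge_prod i j (t : seq S) :
  (forall g, g \in t -> edge_prime i j g) -> order_ge i j (size t) (\prod_(g <- t) g).
Proof.
elim: t => [|g t IHt] tP; first by rewrite big_nil.
rewrite big_cons => m /msuppM_le/allpairsP[[m1 m2] /= [m1g m2t ->]].
have := order_ge_edge_prime (tP g (mem_head _ _)) m1g.
have := IHt (fun h ht => tP h (mem_behead (s := g :: t) ht)) _ m2t; rewrite !mnmDE; lia.
Qed.

Lemma edge_prime_powerE i j k f : i != j ->
  ideal_exp (edge_prime i j) k f <-> order_ge i j k f.
Proof.
move=> ij; split.
  apply: order_ge_sum => _ [t [tP ->]].
  by have := order_ge_prod (t := t) tP; rewrite size_tuple.
move=> fk.
(* The monomial x^m is divisible by x_i^c x_j^(k - c) with c = min (m i) k. *)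
pose c (m : 'X_{1..n}) := minn (m i) k.
pose t (m : 'X_{1..n}) := nseq (c m) ('X_i : S) ++ nseq (k - c m) 'X_j.
have st m : size (t m) == k by rewrite size_cat !size_nseq subnKC ?geq_minr.
pose e (m : 'X_{1..n}) := (U_(i) *+ c m + U_(j) *+ (k - c m))%MM.
have tE m : \prod_(g <- t m) g = 'X_[e m].
  by rewrite big_cat !big_nseq !iter_mulr_1 mpolyXD !mpolyXn.
exists [seq (f@_m *: 'X_[m - e m], 'X_[e m]) | m <- msupp f]; split.
  move=> _ /mapP[m _ ->] /=; exists (Tuple (st m)); split; last by rewrite tE.
  move=> g; rewrite mem_cat => /orP[] /nseqP[-> _].
    by exists [:: (1, 'X_i)]; split; [move=> p; rewrite inE => /eqP->; left|rewrite big_seq1 mul1r].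
  by exists [:: (1, 'X_j)]; split; [move=> p; rewrite inE => /eqP->; right|rewrite big_seq1 mul1r].
rewrite big_map {1}[f]mpolyE big_seq [RHS]big_seq; apply: eq_bigr => m /fk mk /=.
rewrite -scalerAl -mpolyXD submK //; apply/mnm_lepP=> u; rewrite /e mnmDE !mulmnE !mnm1E /c.
have := mk; case: (eqVneq i u) => [<-|iu]; first by rewrite eq_sym (negPf ij); lia.
by case: (eqVneq j u) => [<-|]; lia.
Qed.

Lemma cover_symbolic_powerE (G : sgraph 'I_n) k (f : S) :
  cover_symbolic_power G k f <-> forall m, m \in msupp f -> symbolic_exponent G k m.
Proof.
have neq i j : G i j -> i != j by apply: contraTneq => ->; rewrite adj_irr.
split=> [fI m mf|fI i j Gij].
  apply/symbolic_exponentP=> i j Gij.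
  by have /(edge_prime_powerE _ _ (neq _ _ Gij)) := fI i j Gij; apply.
apply/(edge_prime_powerE _ _ (neq _ _ Gij)) => m /fI/symbolic_exponentP; exact.
Qed.

End EdgePowers.

Theorem corollary4p9 (K : fieldType) (n : nat) (G : sgraph 'I_n) (k : nat)
  (k_gt0 : (0 < k)%N) (k_even : ~~ odd k) :
  regularity_le (@cover_symbolic_power K n G k) (k%:R * gamma0 G).
Proof.
rewrite -(even_halfK k_even); move: k./2 => m F resF i j.
move/eqP; rewrite cards_eq0 => /set0Pn[r]; rewrite inE => /eqP rj.
rewrite leNgt; apply/negP=> /nbhd_gamma0[g gj Hg].
apply: (resolution_generator (r := r) resF) => z zI zg dz.
have zP : koszul_chain (symbolic_exponent G m.*2) i (shift r) z.
  move=> t c ct; have [-> <-] := zg t c ct; split=> //.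
  exact: (iffLR (cover_symbolic_powerE _ _ _) (zI t)).
have [b bj|y yP dy] := koszul_exact _ zP dz.
  apply: (acyclic_upper_koszul (g := g)); first by move=> A; have := Hg A; rewrite card_ord.
  move: gj; rewrite pmulrn ltr_int -rj -bj; lia.
by exists y => // t; apply/cover_symbolic_powerE=> c /yP[].
Qed.
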